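(* Let $\mathcal A,\mathcal Y\in R$. The following are equivalent: (i) $\mathcal A$ is Moore-Penrose invertible and $\mathcal Y=\mathcal A^\dagger$. (ii) $\mathcal A*\mathcal Y*\mathcal A=\mathcal A$, $\mathcal Y*R=\mathcal A^T*R$ and $R*\mathcal Y=R*\mathcal A^T$. (iii) $\mathcal A*\mathcal Y*\mathcal A=\mathcal A$, $\mathrm{lann}(\mathcal Y)=\mathrm{lann}(\mathcal A^T)$ and $\mathrm{rann}(\mathcal Y)=\mathrm{rann}(\mathcal A^T)$. (iv) $\mathcal A*\mathcal Y*\mathcal A=\mathcal A$, $\mathcal Y*R=\mathcal A^T*R$ and $R*\mathcal Y=R*\mathcal A^T$. (v) $\mathcal A*\mathcal Y*\mathcal A=\mathcal A$, $\mathrm{lann}(\mathcal A^T)\subseteq\mathrm{lann}(\mathcal Y)$ and $\mathrm{rann}(\mathcal A^T)\subseteq\mathrm{rann}(\mathcal Y)$.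
   Context: Fix $p\ge 3$ and positive integers $n,n_3,\dots,n_p$; $R=\mathbb{R}^{n\times n\times n_3\times\cdots\times n_p}$ is the set of real tensors of this size, with entrywise addition. For $\mathcal A\in R$ let $\mathcal A_i$ ($1\le i\le n_p$) be the tensor of order $p-1$ obtained by fixing the last index at $i$. The t-product is defined recursively by $(\mathcal A*\mathcal B)_i=\sum_{j=1}^{n_p}\mathcal A_{i-j+1}*\mathcal B_j$ (indices modulo $n_p$ in $\{1,\dots,n_p\}$), where for matrices $*$ is the ordinary matrix product. The transpose is defined recursively by $(\mathcal A^T)_1=(\mathcal A_1)^T$ and $(\mathcal A^T)_i=(\mathcal A_{n_p+2-i})^T$ for $2\le i\le n_p$, with the ordinary transpose for matrices. With these operations $R$ is an associative ring with unity $\mathcal I$ (the tensor whose slice $\mathcal I(:,:,1,\dots,1)$ is the identity matrix and whose other slices are zero), and $(\mathcal A*\mathcal B)^T=\mathcal B^T*\mathcal A^T$. Notation: $\mathcal A*R=\{\mathcal A*\mathcal Z:\mathcal Z\in R\}$, $R*\mathcal A=\{\mathcal Z*\mathcal A:\mathcal Z\in R\}$, $\mathrm{lann}(\mathcal A)=\{\mathcal X\in R:\mathcal X*\mathcal A=\mathcal O\}$, $\mathrm{rann}(\mathcal A)=\{\mathcal X\in R:\mathcal A*\mathcal X=\mathcal O\}$, with $\mathcal O$ the zero tensor. The Moore-Penrose inverse $\mathcal A^\dagger$ of $\mathcal A$ is the tensor $\mathcal Z\in R$ satisfying (1) $\mathcal A*\mathcal Z*\mathcal A=\mathcal A$; (2)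 $\mathcal Z*\mathcal A*\mathcal Z=\mathcal Z$; (3) $(\mathcal A*\mathcal Z)^T=\mathcal A*\mathcal Z$; (4) $(\mathcal Z*\mathcal A)^T=\mathcal Z*\mathcal A$. *)

(* Defs.v *)
From mathcomp Require Import all_boot all_order all_algebra.
From mathcomp Require Import boolp classical_sets reals.

Set Implicit Arguments.
Unset Strict Implicit.
Unset Printing Implicit Defensive.

Import GRing.Theory.
Local Open Scope ring_scope.
Local Open Scope classical_set_scope.

Definition ord_mod k (i : 'I_k) (m : nat) : 'I_k :=
  Ordinal (ltn_pmod m (leq_ltn_trans (leq0n i) (ltn_ord i))).

(* i - j and - i modulo k *)
Definition ord_msub k (i j : 'I_k) : 'I_k := ord_mod i (i + (k - j)).
Definition ord_mopp k (i : 'I_k) : 'I_k := ord_mod i (k - i).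

Section Tensor.
Variables (R : realType) (n : nat) (d : nat -> nat).

(* tensor q is the additive group of real tensors of order q + 2 and size
   n x n x d 3 x ... x d (q + 2), represented by their slices along the last
   index. Slices are numbered from 0, so A 0 is the slice usually written A_1.
   Only the values d 3, ..., d (q + 2) matter. *)
Fixpoint tensor (q : nat) : zmodType :=
  match q with
  | 0 => 'M[R]_n : zmodType
  | q'.+1 => {ffun 'I_(d q'.+3) -> tensor q'} : zmodType
  end.

(* t-product: with 1-based indices, (A * B)_i = \sum_j A_(i - j + 1) * B_j;
   the shift by 1 disappears with 0-based indices. *)
Fixpoint tprod (q : nat) : tensor q -> tensor q -> tensor q :=
  match q return tensor q -> tensor q -> tensor q with
  | 0 => fun A B => A *m B
  | q'.+1 => fun A B =>
      [ffun i : 'I_(d q'.+3) =>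
         \sum_(j < d q'.+3) tprod (A (ord_msub i j)) (B j)]
  end.

(* With 1-based indices and k slices, (A^T)_1 = (A_1)^T and
   (A^T)_i = (A_(k + 2 - i))^T for i >= 2; with 0-based indices both cases
   read i |-> - i modulo k. *)
Fixpoint ttr (q : nat) : tensor q -> tensor q :=
  match q return tensor q -> tensor q with
  | 0 => fun A => A^T
  | q'.+1 => fun A =>
      [ffun i : 'I_(d q'.+3) => ttr (A (ord_mopp i))]
  end.

Variable q : nat.
Implicit Types A X Z : tensor q.

(* A * R and R * A, where R denotes the whole ring of tensors *)
Definition rideal A : set (tensor q) := [set tprod A Z | Z in [set: tensor q]].
Definition lideal A : set (tensor q) := [set tprod Z A | Z in [set: tensor q]].

Definition lann A : set (tensor q) := [set X | tprod X A = 0].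
Definition rann A : set (tensor q) := [set X | tprod A X = 0].

Definition is_MPinverse A Z : Prop :=
  [/\ tprod (tprod A Z) A = A,
      tprod (tprod Z A) Z = Z,
      ttr (tprod A Z) = tprod A Z &
      ttr (tprod Z A) = tprod Z A].

Definition MPinvertible A : Prop := exists Z, is_MPinverse A Z.

(* The solution of the four equations is unique when it exists; the value is 0
   when A is not Moore-Penrose invertible. *)
Definition MPinv A : tensor q := xget 0 [set Z | is_MPinverse A Z].

End Tensor.

(* Main.v *)
Require Import Defs.
From HB Require Import structures.
From mathcomp Require Import all_boot all_algebra.
From mathcomp Require Import boolp classical_sets reals.

(** The equivalence holds in every ring with an involution x |-> tr x that
    reverses products.

    From a y a = a one gets tr a = tr a (tr y tr a) = (tr a tr y) tr a, so that
    1 - tr a tr y annihilates tr a from the left and 1 - tr y tr a annihilates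
    it from the right.  If the annihilators of tr a are contained in those of
    y, then y = tr (y a) y and y = y tr (a y).  Hence y a = tr (y a) (y a) and
    a y = (a y) tr (a y), which are visibly invariant under tr, and then
    y = (y a) y: the four Penrose equations hold ([penrose_of_ann]).
    Conversely the Penrose equations give y = tr a (tr y y) and
    tr a = y (a tr a), together with their mirror images, so that y and tr a
    generate the same one-sided ideals ([penrose_rideal], [penrose_lideal]);
    and a one-sided ideal determines the annihilator of its generator.

    It remains to see that tensors form such a ring.  Along its last index, the
    t-product is a convolution over the cyclic group Z/k with coefficients in
    the tensors of order one less, and the transpose combines i |-> - i with
    the transpose of coefficients.  The ring laws follow by induction on the
    order, through changes of variables in Z/k ([tprodA], [ttrM]). *)

Set Implicit Arguments.
Unset Strict Implicit.
Unset Printing Implicit Defensive.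

Import GRing.Theory.
Local Open Scope ring_scope.
Local Open Scope classical_set_scope.

(** * Penrose equations in a ring with involution *)

Section InvolutionRing.
Variables (S : pzRingType) (tr : S -> S).
Hypothesis trK : involutive tr.
Hypothesis trM : forall a b, tr (a * b) = tr b * tr a.
Implicit Types a b c y z : S.

Definition penrose a y :=
  [/\ a * y * a = a, y * a * y = y, tr (a * y) = a * y & tr (y * a) = y * a].

Definition right_ideal a : set S := [set a * z | z in [set: S]].
Definition left_ideal a : set S := [set z * a | z in [set: S]].
Definition left_ann a : set S := [set x | x * a = 0].
Definition right_ann a : set S := [set x | a * x = 0].

Lemma right_ideal_sub a b c : a = b * c -> right_ideal a `<=` right_ideal b.
Proof. by move=> -> _ [z _ <-]; exists (c * z) => /=; rewrite ?mulrA. Qed.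

Lemma left_ideal_sub a b c : a = c * b -> left_ideal a `<=` left_ideal b.
Proof. by move=> -> _ [z _ <-]; exists (z * c) => /=; rewrite ?mulrA. Qed.

Lemma left_ann_antimono a b :
  right_ideal a `<=` right_ideal b -> left_ann b `<=` left_ann a.
Proof.
rewrite /left_ann => sab x /= xb0; have [|z _ /= bz] := sab a.
  by exists 1; rewrite ?mulr1.
by rewrite -bz mulrA xb0 mul0r.
Qed.

Lemma right_ann_antimono a b :
  left_ideal a `<=` left_ideal b -> right_ann b `<=` right_ann a.
Proof.
rewrite /right_ann => sab x /= bx0; have [|z _ /= zb] := sab a.
  by exists 1; rewrite ?mul1r.
by rewrite -zb -mulrA bx0 mulr0.
Qed.

(** Both [a * y] and [a * z] are self-adjoint idempotents generating the
    same right ideal as [a], hence they are equal.  Dually [y * a = z * a],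
    since both generate the same left ideal as [a]. *)
Lemma penrose_uniq a y z : penrose a y -> penrose a z -> y = z.
Proof.
move=> [aya yay ayT yaT] [aza zaz azT zaT].
have ay_az : a * y = a * z.
  by rewrite -ayT -[in LHS]aza -[a * z * a * y]mulrA trM ayT azT mulrA aya.
have ya_za : y * a = z * a.
  by rewrite -yaT -[in LHS]aza -mulrA mulrA trM yaT zaT -mulrA [a * _]mulrA aya.
by rewrite -yay ya_za -mulrA ay_az mulrA zaz.
Qed.

Lemma penrose_rideal a y :
  penrose a y -> right_ideal y = right_ideal (tr a).
Proof.
move=> [aya yay ayT yaT]; apply/seteqP; split.
  by apply: (@right_ideal_sub _ _ (tr y * y)); rewrite mulrA -trM yaT yay.
by apply: (@right_ideal_sub _ _ (a * tr a)); rewrite mulrA -yaT -trM mulrA aya.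
Qed.

Lemma penrose_lideal a y : penrose a y -> left_ideal y = left_ideal (tr a).
Proof.
move=> [aya yay ayT yaT]; apply/seteqP; split.
  by apply: (@left_ideal_sub _ _ (y * tr y)); rewrite -mulrA -trM ayT mulrA yay.
by apply: (@left_ideal_sub _ _ (tr a * a)); rewrite -mulrA -ayT -trM aya.
Qed.

(** The hypothesis a y a = a puts 1 - tr (y a) in the left annihilator of tr a
    and 1 - tr (a y) in its right annihilator, so both annihilate y. *)
Lemma penrose_of_ann a y : a * y * a = a ->
  left_ann (tr a) `<=` left_ann y -> right_ann (tr a) `<=` right_ann y ->
  penrose a y.
Proof.
move=> aya sl sr.
have yl : y = tr (y * a) * y.
  apply/esym/eqP; rewrite eq_sym -subr_eq0 -{1}[y]mul1r -mulrBl; apply/eqP.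
  by apply: sl; rewrite /left_ann /= mulrBl mul1r -trM mulrA aya subrr.
have yr : y = y * tr (a * y).
  apply/esym/eqP; rewrite eq_sym -subr_eq0 -{1}[y]mulr1 -mulrBr; apply/eqP.
  by apply: sr; rewrite /right_ann /= mulrBr mulr1 -trM aya subrr.
have yaT : tr (y * a) = y * a.
  have ya : y * a = tr (y * a) * (y * a) by rewrite mulrA -yl.
  by rewrite {1}ya trM trK -ya.
have ayT : tr (a * y) = a * y.
  have ay : a * y = a * y * tr (a * y) by rewrite -mulrA -yr.
  by rewrite {1}ay trM trK -ay.
by split; rewrite // -{1}yaT -yl.
Qed.

(** The annihilator conditions are closed into a cycle through the Penrose
    equations: in a ring, elements with the same annihilators need not generate
    the same ideals, but y and tr a do once the Penrose equations hold. *)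
Theorem penrose_tfae a y :
  [<-> penrose a y;
       [/\ a * y * a = a, right_ideal y = right_ideal (tr a) &
           left_ideal y = left_ideal (tr a)];
       [/\ a * y * a = a, left_ann y = left_ann (tr a) &
           right_ann y = right_ann (tr a)];
       [/\ a * y * a = a, right_ideal y = right_ideal (tr a) &
           left_ideal y = left_ideal (tr a)];
       [/\ a * y * a = a, left_ann (tr a) `<=` left_ann y &
           right_ann (tr a) `<=` right_ann y]].
Proof.
have ideals : penrose a y ->
    [/\ a * y * a = a, right_ideal y = right_ideal (tr a) &
        left_ideal y = left_ideal (tr a)].
  by move=> pay; split; [case: pay|exact: penrose_rideal|exact: penrose_lideal].
tfae => //.
- move=> [aya eR eL]; split=> //.
    by apply/seteqP; split; apply: left_ann_antimono; rewrite eR.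
  by apply/seteqP; split; apply: right_ann_antimono; rewrite eL.
- move=> [aya el er]; apply: ideals.
  by apply: penrose_of_ann; rewrite ?el ?er.
- move=> [aya eR eL]; split=> //.
    by apply: left_ann_antimono; rewrite eR.
  by apply: right_ann_antimono; rewrite eL.
- by move=> [aya sl sr]; exact: penrose_of_ann.
Qed.

End InvolutionRing.

(** * Index arithmetic modulo k *)

(** The indices below k + 1 form the group Z/(k + 1), where the identities below
    are immediate; below 0 there is no index. *)
Lemma ord_msubE k (i j : 'I_k.+1) : ord_msub i j = i - j.
Proof. by apply/val_inj; rewrite /= modnDmr. Qed.

Lemma ord_moppE k (i : 'I_k.+1) : ord_mopp i = - i.
Proof. exact/val_inj. Qed.

(** The change of variables behind associativity of a convolution. *)
Lemma ord_msubBB k (i j l : 'I_k) :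
  ord_msub (ord_msub i j) (ord_msub l j) = ord_msub i l.
Proof.
case: k i j l => [[]//|k] i j l.
by rewrite !ord_msubE opprB addrA subrK.
Qed.

Lemma ord_msub_injl k (j : 'I_k) : injective (@ord_msub k ^~ j).
Proof.
case: k j => [[]//|k] j x y.
by rewrite !ord_msubE; apply: addIr.
Qed.

Lemma ord_msub_injr k (i : 'I_k) : injective (ord_msub i).
Proof.
case: k i => [[]//|k] i x y.
by rewrite !ord_msubE => /addrI/oppr_inj.
Qed.

Lemma ord_moppK k : involutive (@ord_mopp k).
Proof. by case: k => [[]//|k] x; rewrite !ord_moppE opprK. Qed.

(** The identity - i - (j - i) = - j, which matches the two convolutions in
    the product rule for the transpose. *)
Lemma ord_mopp_msub k (i j : 'I_k) :
  ord_msub (ord_mopp i) (ord_mopp (ord_msub i j)) = ord_mopp j.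
Proof.
case: k i j => [[]//|k] i j.
by rewrite !(ord_msubE, ord_moppE) opprK addrA addNr add0r.
Qed.

Lemma ord_msub_id0 k (i j : 'I_k) : j == 0 :> nat -> ord_msub i j = i.
Proof.
case: k i j => [[]//|k] i j /eqP j0.
by rewrite ord_msubE (_ : j = 0) ?subr0 //; apply/val_inj.
Qed.

Lemma ord_msub_eq0 k (i j : 'I_k) : (ord_msub i j == 0 :> nat) = (j == i).
Proof.
case: k i j => [[]//|k] i j.
by rewrite ord_msubE [RHS]eq_sym -subr_eq0.
Qed.

(** * The ring of tensors *)

Section TensorRing.
Variables (R : realType) (n : nat) (d : nat -> nat).

Local Notation tensor := (tensor R n d).

Fixpoint tunit (q : nat) : tensor q :=
  match q return tensor q with
  | 0 => 1%:M
  | q'.+1 =>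
      [ffun i : 'I_(d q'.+3) => if i == 0 :> nat then tunit q' else 0]
  end.

(** Slices of a tensor of order at least 3.  The rules below rewrite one level
    of the recursive definitions and keep them folded at the level below. *)
Definition slice q (A : tensor q.+1) (i : 'I_(d q.+3)) : tensor q :=
  (A : {ffun 'I_(d q.+3) -> tensor q}) i.

Lemma sliceP q (A B : tensor q.+1) : slice A =1 slice B -> A = B.
Proof. by move=> AB; apply/ffunP. Qed.

Lemma sliceD q (A B : tensor q.+1) i :
  slice (A + B) i = slice A i + slice B i.
Proof. exact: ffunE. Qed.

Lemma slice_tprod q (A B : tensor q.+1) i :
  slice (tprod A B) i =
  \sum_(j < d q.+3) tprod (slice A (ord_msub i j)) (slice B j).
Proof. exact: ffunE. Qed.

Lemma slice_ttr q (A : tensor q.+1) i :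
  slice (ttr A) i = ttr (slice A (ord_mopp i)).
Proof. exact: ffunE. Qed.

Lemma slice_tunit q i :
  slice (tunit q.+1) i = if i == 0 :> nat then tunit q else 0.
Proof. exact: ffunE. Qed.

Lemma tprodDl q (A B C : tensor q) :
  tprod (A + B) C = tprod A C + tprod B C.
Proof.
elim: q A B C => [|q IHq] A B C; first exact: mulmxDl.
apply/sliceP=> i; rewrite sliceD !slice_tprod -big_split; apply: eq_bigr => j _.
by rewrite sliceD IHq.
Qed.

Lemma tprodDr q (A B C : tensor q) :
  tprod A (B + C) = tprod A B + tprod A C.
Proof.
elim: q A B C => [|q IHq] A B C; first exact: mulmxDr.
apply/sliceP=> i; rewrite sliceD !slice_tprod -big_split; apply: eq_bigr => j _.
by rewrite sliceD IHq.
Qed.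

Lemma tprod0l q (A : tensor q) : tprod 0 A = 0.
Proof. by apply: (addIr (tprod 0 A)); rewrite -tprodDl !add0r. Qed.

Lemma tprod0r q (A : tensor q) : tprod A 0 = 0.
Proof. by apply: (addIr (tprod A 0)); rewrite -tprodDr !add0r. Qed.

Lemma tprod_suml q (I : finType) (F : I -> tensor q) A :
  tprod (\sum_i F i) A = \sum_i tprod (F i) A.
Proof.
exact: (big_morph (fun B => tprod B A) (fun B C => tprodDl B C A) (tprod0l A)).
Qed.

Lemma tprod_sumr q (I : finType) (F : I -> tensor q) A :
  tprod A (\sum_i F i) = \sum_i tprod A (F i).
Proof. exact: (big_morph (tprod A) (tprodDr A) (tprod0r A)). Qed.

Lemma tprodA q (A B C : tensor q) :
  tprod A (tprod B C) = tprod (tprod A B) C.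
Proof.
elim: q A B C => [|q IHq] A B C; first exact: mulmxA.
apply/sliceP=> i; rewrite !slice_tprod.
under eq_bigr do rewrite slice_tprod tprod_sumr.
rewrite exchange_big; apply: eq_bigr => j _; rewrite slice_tprod tprod_suml.
rewrite [RHS](reindex_inj (@ord_msub_injl _ j)).
by apply: eq_bigr => k _; rewrite IHq ord_msubBB.
Qed.

Lemma tprod1l q (A : tensor q) : tprod (tunit q) A = A.
Proof.
elim: q A => [|q IHq] A; first exact: mul1mx.
apply/sliceP=> i; rewrite slice_tprod (bigD1 i) //=.
rewrite slice_tunit ord_msub_eq0 eqxx IHq big1 ?addr0 // => j /negPf ji.
by rewrite slice_tunit ord_msub_eq0 ji tprod0l.
Qed.

Lemma tprod1r q (A : tensor q) : tprod A (tunit q) = A.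
Proof.
elim: q A => [|q IHq] A; first exact: mulmx1.
apply/sliceP=> i; rewrite slice_tprod.
(* The index 0 of the nonzero slice of the unit is reached as i - i, which
   avoids having to exhibit an element of the index type. *)
rewrite (reindex_inj (@ord_msub_injr _ i)) (bigD1 i) //=.
have ii0 : ord_msub i i == 0 :> nat by rewrite ord_msub_eq0.
rewrite slice_tunit ii0 (ord_msub_id0 i ii0) IHq.
rewrite big1 ?addr0 // => j /negPf ji.
by rewrite slice_tunit ord_msub_eq0 ji tprod0r.
Qed.

Lemma ttrK q : involutive (@ttr R n d q).
Proof.
elim: q => [|q IHq] A; first exact: trmxK.
by apply/sliceP=> i; rewrite !slice_ttr ord_moppK IHq.
Qed.

Lemma ttrD q (A B : tensor q) : ttr (A + B) = ttr A + ttr B.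
Proof.
elim: q A B => [|q IHq] A B; first exact: linearD.
by apply/sliceP=> i; rewrite !(sliceD, slice_ttr) IHq.
Qed.

Lemma ttr0 q : ttr (0 : tensor q) = 0.
Proof. by apply: (addIr (ttr 0)); rewrite -ttrD !add0r. Qed.

Lemma ttrM q (A B : tensor q) : ttr (tprod A B) = tprod (ttr B) (ttr A).
Proof.
elim: q A B => [|q IHq] A B; first exact: trmx_mul.
apply/sliceP=> i; rewrite slice_ttr !slice_tprod.
rewrite (big_morph (@ttr R n d q) (@ttrD q) (ttr0 q)).
(* Both sums run over the pairs of slices of A and B whose indices add up to
   - i: the slice of A has index - i - j on the left and - j on the right. *)
rewrite (reindex_inj (inj_comp (inv_inj (@ord_moppK _)) (@ord_msub_injr _ i))).
by apply: eq_bigr => j _; rewrite /= ord_mopp_msub IHq !slice_ttr.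
Qed.

(** A name of its own for the carrier, on which the t-product can be registered
    as the ring multiplication; [tensor q] itself is already a packed additive
    group, whose carrier may reduce to matrices or to functions. *)
Definition tensor_ring (q : nat) : Type := tensor q.
HB.instance Definition _ q := GRing.Zmodule.on (tensor_ring q).
HB.instance Definition _ q := GRing.Zmodule_isPzRing.Build (tensor_ring q)
  (@tprodA q) (@tprod1l q) (@tprod1r q) (@tprodDl q) (@tprodDr q).

(** Uniqueness of the Moore-Penrose inverse turns the chosen solution of the
    Penrose equations into any given one. *)
Lemma MPinvP q (A Y : tensor q) :
  MPinvertible A /\ Y = MPinv A <-> is_MPinverse A Y.
Proof.
split=> [[AZ ->] | AY]; first exact: (xgetPex 0 AZ).
have AZ : MPinvertible A by exists Y.
split=> //.
exact: (@penrose_uniq (tensor_ring q) _ (@ttrM q) A _ _ AY (xgetPex 0 AZ)).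
Qed.

End TensorRing.

Theorem theorem14 (R : realType) (p n : nat) (d : nat -> nat)
    (hp : (3 <= p)%N) (hn : (0 < n)%N)
    (hd : forall k : nat, (3 <= k <= p)%N -> (0 < d k)%N)
    (A Y : tensor R n d (p - 2)) :
  [<-> MPinvertible A /\ Y = MPinv A;
       [/\ tprod (tprod A Y) A = A,
           rideal Y = rideal (ttr A) &
           lideal Y = lideal (ttr A)];
       [/\ tprod (tprod A Y) A = A,
           lann Y = lann (ttr A) &
           rann Y = rann (ttr A)];
       [/\ tprod (tprod A Y) A = A,
           rideal Y = rideal (ttr A) &
           lideal Y = lideal (ttr A)];
       [/\ tprod (tprod A Y) A = A,
           lann (ttr A) `<=` lann Y &
           rann (ttr A) `<=` rann Y]].
Proof.
rewrite (propext (MPinvP A Y)).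
exact: (@penrose_tfae (tensor_ring R n d (p - 2)) _
          (@ttrK R n d (p - 2)) (@ttrM R n d (p - 2))).
Qed.
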